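(* Let $G=(V,E)$ be an infinite connected graph of bounded degree, let $p_c$ be the critical probability of independent bond percolation on $G$, and let $x\in V$. If there exists a finite constant $C_1$ such that ${\mathbb E}_{p}|C(x)| \leq C_1 (p_c - p)^{-1}$ for all $p\in[0,p_c)$, then there exists a finite constant $C_2$ such that for all integers $n\geq 1$, \[ {\mathbb E}_{p_c}|B_I(x,n)| \leq C_2 n. \]
   Context: Independent bond percolation on $G=(V,E)$ with parameter $p\in[0,1]$: each edge of $G$ is open with probability $p$ and closed with probability $1-p$, independently for distinct edges. The resulting product measure is denoted by ${\mathbb P}_p$, and ${\mathbb E}_p$ denotes expectation with respect to ${\mathbb P}_p$. For $x,y\in V$ and an integer $n$, write $x\leftrightarrow y$ if there is an open path (a path all of whose edges are open) from $x$ to $y$, and $x\stackrel{\leq n}\longleftrightarrow y$ if there is an open path of at most $n$ edges from $x$ to $y$. A vertex is connected to itself by the path with no edges. $C(x)$ is the (random) set of all $y\in V$ such that $x\leftrightarrow y$. The intrinsic ball of radius $n$ at $x$ is the (random) set $B_I(x,n)$ of all $y\in V$ such that $x\stackrel{\leq n}\longleftrightarrow y$. $|A|$ denotes the cardinality of a set $A$. The critical percolation probability is $p_c = \inf \{p\in[0,1] : {\mathbb P}_p(|C(x)|=\infty)>0\}$; it does not depend on the choice of $x\in V$, since $G$ is connected. *)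

(* Defs.v *)
From HB Require Import structures.
From mathcomp Require Import all_boot all_order all_algebra.
From mathcomp Require Import finmap.
From mathcomp Require Import all_classical all_reals all_analysis.

Set Implicit Arguments.
Unset Strict Implicit.
Unset Printing Implicit Defensive.

Import Order.TTheory GRing.Theory Num.Theory.
Import numFieldNormedType.Exports.

Local Open Scope classical_set_scope.
Local Open Scope ring_scope.

Section Graphs.
Variables (V : choiceType) (E : set {fset V}).

(* The graph (V, E): an edge is an unordered pair of distinct vertices. *)
Definition simple_graph := forall e, E e -> #|` e| = 2%N.

Definition adj (u v : V) : bool := `[< E [fset u; v]%fset >].

Definition is_path (r : rel V) (x y : V) (s : seq V) :=
  [/\ path r x s, last x s = y & uniq (x :: s)].

Definition connected_graph := forall x y : V, exists s, is_path adj x y s.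

Definition bounded_degree :=
  exists D : nat, forall u : V, ([set e | E e /\ u \in e] #<= `I_D)%card.

(* Configurations (true = open edge), with the product sigma-algebra, i.e. the
   one generated by the coordinate maps. *)
Definition coordinate_events : set (set (E -> bool)) :=
  [set A | exists (e : E) (B : set bool), A = [set w | B (w e)]].

Definition config := g_sigma_algebraType coordinate_events.

(* mu is the product over E of the Bernoulli(p) distributions, characterised by
   its values on the finite cylinders. *)
Definition bernoulli_percolation (R : realType) (p : R)
    (mu : probability config R) :=
  forall (F : {fset E}) (b : E -> bool),
    mu [set w : config | forall e : E, e \in F -> w e = b e] =
    (\prod_(e <- F) (if b e then p else 1 - p))%:E.

Definition open_adj (w : config) (u v : V) : bool :=
  `[< exists e : E, val e = [fset u; v]%fset /\ w e = true >].

Definition open_cluster (w : config) (x : V) : set V :=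
  [set y | exists s, is_path (open_adj w) x y s].

(* size s is the number of edges of the path x :: s. *)
Definition intrinsic_ball (w : config) (x : V) (n : nat) : set V :=
  [set y | exists s, is_path (open_adj w) x y s /\ (size s <= n)%N].

Definition critical_prob (R : realType) (P : R -> probability config R)
    (x : V) : R :=
  inf [set p : R | 0 <= p <= 1 /\
    (0 < P p [set w : config | infinite_set (open_cluster w x)])%E].

End Graphs.

Arguments open_cluster {V E} w x.
Arguments intrinsic_ball {V E} w x n.
Arguments bernoulli_percolation {V E R} p mu.
Arguments critical_prob {V E R} P x.

(* Main.v *)
Require Import Defs.
From HB Require Import structures.
From mathcomp Require Import all_boot all_order all_algebra.
From mathcomp Require Import finmap ring lra.
From mathcomp Require Import all_classical all_reals all_analysis.
From mathcomp Require Import measurable_realfun.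

Set Implicit Arguments.
Unset Strict Implicit.
Unset Printing Implicit Defensive.

Import Order.TTheory GRing.Theory Num.Theory.
Import numFieldNormedType.Exports.

Local Open Scope classical_set_scope.
Local Open Scope ring_scope.

(** Write [pc] for the critical probability. Percolation at a subcritical
    parameter [pc * r] is obtained from critical percolation by keeping each
    open edge independently with probability [r]. If [y] lies in the critical
    ball of radius [n], then some open path with at most [n] edges leads from [x]
    to [y], and this one path survives the thinning with probability at least
    [r ^+ n]. Summing over [y],

      r ^+ n * E_pc |B_I(x, n)| <= E_(pc * r) |B_I(x, n)| <= E_(pc * r) |C(x)|.

    Taking [1 - r = 1 / (2 n)] keeps [r ^+ n] above 1/2 by the inequality of
    Bernoulli, while [pc - pc * r = pc / (2 n)], so that the hypothesis bounds the
    right-hand side by a multiple of [n].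

    Everything happens on finitely many edges: in a locally finite graph the
    ball of radius [n] is a function of the states of the finitely many edges
    within distance [n] of [x]. The thinning inequality is therefore a
    statement about finite sums ([finite_thinning]), carried over to the
    percolation measures by [percolation_local_event] and [percolation_thinning]
    and summed over the vertices in [expectation_intrinsic_ball_thinning].

    The argument divides by [pc]. When [pc = 0], all edges are closed almost
    surely at [pc] and the ball is almost surely [{x}]
    ([expectation_intrinsic_ball0]), so that no lower bound on [pc] has to be
    established. *)

(** * Thinning of finite Bernoulli configurations *)

Definition bernoulli_weight (R : numDomainType) (I : finType) (p : R)
    (a : {ffun I -> bool}) : R :=
  \prod_i (if a i then p else 1 - p).

Lemma bernoulli_weight_ge0 (R : numDomainType) (I : finType) (p : R)
    (a : {ffun I -> bool}) : 0 <= p <= 1 -> 0 <= bernoulli_weight p a.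
Proof.
by move=> /andP[p0 p1]; apply: prodr_ge0 => i _; case: ifP => // _; rewrite subr_ge0.
Qed.

(** The survival probability of a witness. Repetitions in [t] do not cost
    anything, hence the cardinal of the set of its entries. *)
Lemma sum_bernoulli_weight_on (R : numDomainType) (I : finType) (p : R)
    (t : seq I) :
  \sum_(k : {ffun I -> bool} | all k t) bernoulli_weight p k
    = p ^+ #|[set i in t]%SET|.
Proof.
(* The constraint that [k] is true along [t] goes into the factors, after which
   the sum over [k] distributes over the product. *)
pose c i (b : bool) : R :=
  if (i \in t) && ~~ b then 0 else if b then p else 1 - p.
transitivity (\prod_i \sum_b c i b); last first.
  rewrite (eq_bigr (fun i => if i \in [set i in t]%SET then p else 1)); last first.
    move=> i _; rewrite inE (bigD1 true)//= (bigD1 false)//= big1.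
      by rewrite /c !andbF !andbT; case: ifP => _; rewrite addr0 ?addr0 // addrC subrK.
    by case.
  by rewrite -big_mkcond/= prodr_const.
rewrite bigA_distr_bigA/= [LHS]big_mkcond/=; apply: eq_bigr => k _.
case: ifPn => [/allP kt|/allPn[i it kiN]].
  apply: eq_bigr => i _; rewrite /c.
  by case: (boolP (i \in t)) => //= /kt ->.
by rewrite (bigD1 i)//= /c it kiN mul0r.
Qed.

(** The coupling: the pointwise conjunction of independent Bernoulli(q) and
    Bernoulli(r) configurations is a Bernoulli(q r) configuration. *)
Lemma sum_bernoulli_weight_thinning (R : numDomainType) (I : finType) (q r : R)
    (f : {ffun I -> bool} -> R) :
  \sum_a \sum_k bernoulli_weight q a * bernoulli_weight r k
      * f [ffun i => a i && k i]
    = \sum_b bernoulli_weight (q * r) b * f b.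
Proof.
pose u (p : R) (b : bool) := if b then p else 1 - p.
have weightM (b : {ffun I -> bool}) : bernoulli_weight (q * r) b =
    \sum_a \sum_k (bernoulli_weight q a * bernoulli_weight r k)
      * (b == [ffun i => a i && k i])%:R.
  transitivity (\prod_i \sum_x \sum_y
      u q x * u r y * (b i == x && y)%:R : R).
    apply: eq_bigr => i _; rewrite !big_bool/= /u.
    by case: (b i) => /=; ring.
  rewrite bigA_distr_bigA/=; apply: eq_bigr => a _.
  rewrite bigA_distr_bigA/=; apply: eq_bigr => k _.
  rewrite !big_split/=; congr (_ * _).
  case: eqP => [->|/eqP bN]; first by rewrite big1// => i _; rewrite ffunE eqxx.
  apply/eqP/prodf_eq0.
  have /existsP[i bi] : [exists i, b i != (a i && k i)].
    rewrite -negb_forall; apply: contra bN => /forallP bE.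
    by apply/eqP/ffunP => i; rewrite ffunE; apply/eqP.
  by exists i => //; rewrite (negbTE bi).
under [RHS]eq_bigr do rewrite weightM mulr_suml.
rewrite [RHS]exchange_big/=; apply: eq_bigr => a _.
under [RHS]eq_bigr do rewrite mulr_suml.
rewrite [RHS]exchange_big/=; apply: eq_bigr => k _.
rewrite (bigD1 [ffun i => a i && k i])//= eqxx mulr1 big1 ?addr0// => b bN.
by rewrite (negbTE bN) mulr0 mul0r.
Qed.

(** Given a configuration [a] in [A] with witness [t], the conjunction of [a]
    with an independent Bernoulli(r) configuration [k] stays in [A] whenever [k]
    is true along [t], which has probability at least [r ^+ n]. The hypothesis
    says that [A] is an increasing event whose minimal elements have at most [n]
    true entries. *)
Lemma finite_thinning (R : numDomainType) (I : finType) (q r : R) (n : nat)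
    (A : pred {ffun I -> bool}) :
  0 <= q <= 1 -> 0 <= r <= 1 ->
  (forall a, A a -> exists t : seq I, [/\ (size t <= n)%N, all a t &
     forall b : {ffun I -> bool}, all b t -> A b]) ->
  r ^+ n * \sum_(a | A a) bernoulli_weight q a
    <= \sum_(b | A b) bernoulli_weight (q * r) b.
Proof.
move=> q01 r01 witness; have /andP[r0 r1] := r01.
rewrite [leRHS]big_mkcond/=.
rewrite [leRHS](eq_bigr (fun b => bernoulli_weight (q * r) b * (A b)%:R));
  last by move=> b _; case: ifP => _; rewrite ?mulr1 ?mulr0.
rewrite -sum_bernoulli_weight_thinning mulr_sumr big_mkcond/=.
apply: ler_sum => a _; under eq_bigr do rewrite -mulrA.
rewrite -mulr_sumr; case: ifPn => [Aa|_]; last first.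
  apply: mulr_ge0; first exact: bernoulli_weight_ge0.
  by apply: sumr_ge0 => k _; rewrite mulr_ge0// bernoulli_weight_ge0.
rewrite mulrC ler_wpM2l ?bernoulli_weight_ge0//.
have [t [tn at_ tA]] := witness _ Aa.
have le_tn : (#|[set i in t]%SET| <= n)%N.
  by rewrite cardsE (leq_trans (card_size t)).
apply: (@le_trans _ _ (r ^+ #|[set i in t]%SET|)); first exact: ler_wiXn2l.
rewrite -sum_bernoulli_weight_on big_mkcond/=; apply: ler_sum => k _.
case: ifPn => [kt|_]; last by rewrite mulr_ge0// bernoulli_weight_ge0.
rewrite tA ?mulr1//; apply/allP => i it.
by rewrite ffunE (allP at_ _ it) (allP kt _ it).
Qed.

(** * Events depending on finitely many edges *)

Section LocalEvents.
Variables (V : choiceType) (E : set {fset V}).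
Implicit Types (F : {fset E}) (A : set (config E)).

Definition depends_only_on F A := forall w w' : config E,
  (forall e, e \in F -> w e = w' e) -> A w -> A w'.

Definition cylinder F (c : {ffun F -> bool}) : set (config E) :=
  [set w | forall e : F, w (val e) = c e].

(** Local events do not see the value given outside [F]; all edges there are
    closed. *)
Definition zero_extension F (c : {ffun F -> bool}) : config E :=
  fun e => if insub e is Some e' then c e' else false.

Lemma zero_extensionE F (c : {ffun F -> bool}) (e : F) :
  zero_extension c (val e) = c e.
Proof. by rewrite /zero_extension valK. Qed.

Lemma measurable_cylinder F (c : {ffun F -> bool}) : measurable (cylinder c).
Proof.
have -> : cylinder c =
    \bigcap_(e in [set: F]) [set w : config E | w (val e) = c e].
  by apply/seteqP; split=> w /= cw e; [move=> _; exact: cw | exact: cw].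
apply: fin_bigcap_measurable => [|e _]; first exact: finite_finset.
by apply: sub_sigma_algebra; exists (val e), [set c e].
Qed.

Lemma depends_only_on_cylinders F A : depends_only_on F A ->
  A = \bigcup_(c in [set c | A (@zero_extension F c)]) cylinder c.
Proof.
move=> AF; apply/seteqP; split=> [w Aw|w [c /= Ac cw]].
  exists [ffun e => w (val e)]; last by move=> e; rewrite ffunE.
  apply: AF Aw => e eF.
  by rewrite -[e]/(val [` eF]%fset) zero_extensionE ffunE.
apply: AF Ac => e eF.
by rewrite -[e]/(val [` eF]%fset) zero_extensionE cw.
Qed.

Lemma measurable_depends_only_on F A : depends_only_on F A -> measurable A.
Proof.
move=> /depends_only_on_cylinders ->; apply: fin_bigcup_measurable.
  exact: finite_finset.
by move=> c _; exact: measurable_cylinder.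
Qed.

Lemma percolation_cylinder (R : realType) (p : R)
    (mu : probability (config E) R) F (c : {ffun F -> bool}) :
  bernoulli_percolation p mu -> mu (cylinder c) = (bernoulli_weight p c)%:E.
Proof.
move=> /(_ F (zero_extension c)) muE.
have -> : cylinder c =
    [set w : config E | forall e, e \in F -> w e = zero_extension c e].
  apply/seteqP; split=> w /= cw e; last by rewrite cw ?zero_extensionE//; exact: valP.
  by move=> eF; rewrite -[e]/(val [` eF]%fset) cw zero_extensionE.
rewrite muE big_seq_fsetE/=; congr EFin.
by apply: eq_bigr => e _; rewrite zero_extensionE.
Qed.

Lemma percolation_local_event (R : realType) (p : R)
    (mu : probability (config E) R) F A :
  bernoulli_percolation p mu -> depends_only_on F A ->
  mu A = (\sum_(c | `[< A (@zero_extension F c) >]) bernoulli_weight p c)%:E.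
Proof.
move=> muE AF; rewrite {1}(depends_only_on_cylinders AF) measure_fin_bigcup.
- rewrite -sumEFin -[RHS]big_filter [RHS]fsbig_seq ?filter_uniq ?index_enum_uniq//.
  have <- : [set c | A (@zero_extension F c)] =
      [set` [seq c <- index_enum _ | `[< A (@zero_extension F c) >]]].
    apply/seteqP; split=> c /=; rewrite mem_filter mem_index_enum andbT.
      by move/asboolP.
    by move/asboolP.
  by apply: eq_fsbigr => c _; exact: percolation_cylinder.
- exact: finite_finset.
- move=> c c' _ _ [w [cw c'w]]; apply/ffunP => e.
  by rewrite -cw -c'w.
- by move=> c _; exact: measurable_cylinder.
Qed.

(** Each occurrence of [A] is forced by at most [n] open edges, all in [F]. This
    makes [A] increasing and determined by the edges of [F]. *)
Definition witnessed F (n : nat) A := forall w, A w -> exists t : seq E,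
  [/\ (size t <= n)%N, {subset t <= F}, all w t &
      forall w' : config E, all w' t -> A w'].

Lemma witnessed_depends_only_on F n A : witnessed F n A -> depends_only_on F A.
Proof.
move=> Awit w w' ww' /Awit[t [_ tF wt]]; apply; apply/allP => e et.
by rewrite -ww' ?tF// (allP wt).
Qed.

(** A larger parameter makes an event witnessed by at most [n] open edges more
    likely, but by a factor of at most [r ^- n]: the two measures need not live
    on a common probability space, since both are computed from [F]. *)
Lemma percolation_thinning (R : realType) (q r : R)
    (mu nu : probability (config E) R) F n A :
  0 <= q <= 1 -> 0 <= r <= 1 ->
  bernoulli_percolation q mu -> bernoulli_percolation (q * r) nu ->
  witnessed F n A ->
  ((r ^+ n)%:E * mu A <= nu A)%E.
Proof.
move=> q01 r01 muE nuE Awit; have AF := witnessed_depends_only_on Awit.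
rewrite (percolation_local_event muE AF) (percolation_local_event nuE AF).
rewrite -EFinM lee_fin finite_thinning// => a /asboolP /Awit[t [tn tF ta tA]].
exists (pmap insub t); split.
- by rewrite size_pmap_sub (leq_trans (count_size _ _)).
- apply/allP => e; rewrite mem_pmap_sub => /(allP ta).
  by rewrite zero_extensionE.
- move=> b /allP bt; apply/asboolP/tA/allP => e et.
  rewrite -[e]/(val [` tF _ et]%fset) zero_extensionE.
  by apply: bt; rewrite mem_pmap_sub.
Qed.

(** At parameter 0 the configuration is almost surely closed on [F]. *)
Lemma percolation0_local_event (R : realType) (mu : probability (config E) R)
    F A :
  bernoulli_percolation 0 mu -> depends_only_on F A ->
  ~ A (fun=> false) -> mu A = 0%E.
Proof.
move=> muE AF A0; rewrite (percolation_local_event muE AF) big1// => c /asboolP Ac.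
apply/eqP/prodf_eq0.
have /existsP[e ce] : [exists e, c e].
  apply: contrapT => /negP; rewrite negb_exists => /forallP c0; apply: A0; apply: AF Ac => e eF.
  by rewrite -[e]/(val [` eF]%fset) zero_extensionE; apply/negbTE/c0.
by exists e => //; rewrite ce.
Qed.

End LocalEvents.

(** * Intrinsic balls in locally finite graphs *)

Section LocalFiniteness.
Variables (V : choiceType) (E : set {fset V}).

Definition edges_at (u : V) : set E := [set e : E | u \in val e].

(** The edges that a path with at most [n] edges starting at [u] can use. The
    recursion lets the next step start from either endpoint of [e], so that it
    makes sense for arbitrary finite sets [e] and gives finiteness directly. *)
Fixpoint edges_within (u : V) (n : nat) : set E :=
  if n is m.+1 then
    edges_at u `|`
      \bigcup_(e in edges_at u) \bigcup_(v in [set` val (e : E)]) edges_within v m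
  else set0.

Lemma finite_edges_within (u : V) (n : nat) :
  bounded_degree E -> finite_set (edges_within u n).
Proof.
move=> [D degE].
have finite_edges_at v : finite_set (edges_at v).
  have -> : edges_at v = val @^-1` [set e | E e /\ v \in e].
    apply/seteqP; split=> e /=; last by case.
    by move=> ve; split => //; exact: set_valP.
  apply: finite_preimage; first by move=> e e' _ _; exact: val_inj.
  by apply: card_le_finite (degE v) _; exact: finite_II.
elim: n u => [|n IH] u /=; first exact: finite_set0.
rewrite finite_setU; split => //; apply: bigcup_finite => // e _.
by apply: bigcup_finite => [|v _]; [exact: finite_fset | exact: IH].
Qed.

(** The edges of an open path witness its openness. As [open_adj] hides the
    edge behind an existential, a list [t] of actual edges has to be extracted. *)
Lemma open_path_witness (w : config E) (n : nat) (u : V) (s : seq V) :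
  (size s <= n)%N -> path (open_adj w) u s ->
  exists t : seq E, [/\ size t = size s, all w t,
    forall e, e \in t -> edges_within u n e &
    forall w' : config E, all w' t -> path (open_adj w') u s].
Proof.
elim: s n u => [|v s IH] [|n] u //= sn; try by exists [::].
move=> /andP[/asboolP[e [eE we]] /(IH n _ sn)[t [ts wt tn pt]]].
have ue : u \in val e by rewrite eE !inE eqxx.
have ve : v \in val e by rewrite eE !inE eqxx orbT.
exists (e :: t); split=> /=.
- by rewrite ts.
- by rewrite we.
- move=> e'; rewrite inE => /orP[/eqP ->|/tn e't]; first by left.
  by right; exists e => //; exists v.
- move=> w' /andP[w'e /pt ->]; rewrite andbT.
  by apply/asboolP; exists e.
Qed.

Lemma open_path_last (w : config E) (n : nat) (u : V) (s : seq V) :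
  (size s <= n)%N -> path (open_adj w) u s ->
  last u s = u \/ exists2 e, edges_within u n e & last u s \in val e.
Proof.
elim: s n u => [|v s IH] [|n] u //= sn; try by left.
move=> /andP[/asboolP[e [eE we]] /(IH n _ sn) vs]; right.
have ue : u \in val e by rewrite eE !inE eqxx.
have ve : v \in val e by rewrite eE !inE eqxx orbT.
case: vs => [->|[e' e'v le']]; first by exists e => //; left.
by exists e' => //; right; exists e => //; exists v.
Qed.

Lemma intrinsic_ball_witnessed (F : {fset E}) (x y : V) (n : nat) :
  edges_within x n `<=` [set` F] ->
  witnessed F n [set w | intrinsic_ball w x n y].
Proof.
move=> xF w [s [[ps sy us] sn]].
have [t [ts wt tx pt]] := open_path_witness sn ps.
exists t; split => //; first by rewrite ts.
- by move=> e /tx /xF.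
- by move=> w' /pt ps'; exists s.
Qed.

(** The range [Y] does not depend on the configuration: this turns the expected
    size of the ball into a finite sum of probabilities. *)
Lemma intrinsic_ball_finite_range (x : V) (n : nat) : bounded_degree E ->
  exists Y : {fset V}, forall w : config E, intrinsic_ball w x n `<=` [set` Y].
Proof.
move=> degE.
have finY : finite_set
    (x |` \bigcup_(e in edges_within x n) [set` val e]).
  rewrite finite_setU; split; first exact: finite_set1.
  apply: bigcup_finite => [|e _]; [exact: finite_edges_within|exact: finite_fset].
exists (fset_set (x |` \bigcup_(e in edges_within x n) [set` val e])).
rewrite fset_setK// => w y [s [[ps <- _] sn]].
have [->|[e xe le]] := open_path_last sn ps; first by left.
by right; exists e.
Qed.

Lemma closed_intrinsic_ball (x y : V) (n : nat) :
  @intrinsic_ball V E (fun=> false) x n y -> y = x.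
Proof.
move=> [[|v s] [[/= ps <- _] _]] //.
by move: ps => /andP[/asboolP[e [_]]].
Qed.

End LocalFiniteness.

(** * Expected size of intrinsic balls *)

Lemma counting_sum (R : realType) (T : choiceType) (Y : {fset T}) (B : set T) :
  B `<=` [set` Y] -> counting B = (\sum_(y <- Y) (y \in B)%:R%:E)%E :> \bar R.
Proof.
move=> BY; have finB : finite_set B by apply: sub_finite_set BY _; exact: finite_fset.
rewrite /counting asboolT// sumEFin -natr_sum; congr (_%:R%:E).
rewrite card_fset_sum1 -big_mkcond/= -[RHS]big_filter.
apply: perm_big; apply: uniq_perm; rewrite ?filter_uniq ?fset_uniq//.
move=> y; rewrite mem_filter in_fset_set//.
by case: (boolP (y \in B)) => // /set_mem /BY.
Qed.

(** Monotonicity holds without measurability, because the integral of a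
    nonnegative function is a supremum over the simple functions below it. This
    serves for the size of the cluster, which depends on infinitely many edges
    and whose measurability is thus not immediate. *)
Lemma ge0_le_integral_nonmeasurable d (T : measurableType d) (R : realType)
    (mu : {measure set T -> \bar R}) (f g : T -> \bar R) :
  (forall t, 0 <= f t)%E -> (forall t, f t <= g t)%E ->
  (\int[mu]_t f t <= \int[mu]_t g t)%E.
Proof.
move=> f0 fg; rewrite !ge0_integralTE//; last first.
  by move=> t; exact: le_trans (f0 t) (fg t).
apply: ereal_sup_le => _ [h hf <-] /=; exists h => // t.
exact: le_trans (hf t) (fg t).
Qed.

Lemma expectation_intrinsic_ball (R : realType) (V : choiceType)
    (E : set {fset V}) (mu : probability (config E) R) (x : V) (n : nat)
    (F : {fset E}) (Y : {fset V}) :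
  edges_within x n `<=` [set` F] ->
  (forall w : config E, intrinsic_ball w x n `<=` [set` Y]) ->
  (\int[mu]_w counting (intrinsic_ball w x n)
    = \sum_(y <- Y) mu [set w | intrinsic_ball w x n y])%E.
Proof.
move=> xF xY.
have mball y : measurable [set w : config E | intrinsic_ball w x n y].
  have := witnessed_depends_only_on (intrinsic_ball_witnessed (y := y) xF).
  exact: measurable_depends_only_on.
transitivity (\int[mu]_w \sum_(y <- Y)
    (\1_[set w' : config E | intrinsic_ball w' x n y] w)%:E)%E.
  apply: eq_integral => w _; rewrite (counting_sum _ (xY w)).
  by apply: eq_bigr => y _; rewrite indicE; congr (_%:R%:E).
rewrite ge0_integral_sum//.
- by apply: eq_bigr => y _; rewrite integral_indic// setIT.
- by move=> y; apply/measurable_EFinP; exact: measurable_indic.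
Qed.

Lemma expectation_intrinsic_ball_thinning (R : realType) (V : choiceType)
    (E : set {fset V}) (q r : R) (mu nu : probability (config E) R)
    (x : V) (n : nat) :
  bounded_degree E -> 0 <= q <= 1 -> 0 <= r <= 1 ->
  bernoulli_percolation q mu -> bernoulli_percolation (q * r) nu ->
  ((r ^+ n)%:E * (\int[mu]_w counting (intrinsic_ball w x n))
    <= \int[nu]_w counting (intrinsic_ball w x n))%E.
Proof.
move=> degE q01 r01 muE nuE.
have /finite_fsetP[F FE] := finite_edges_within x n degE.
have [Y xY] := intrinsic_ball_finite_range x n degE.
have xF : edges_within x n `<=` [set` F] by rewrite FE.
rewrite !(expectation_intrinsic_ball _ xF xY) ge0_sume_distrr//.
apply: lee_sum => y _; apply: percolation_thinning q01 r01 muE nuE _.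
exact: intrinsic_ball_witnessed xF.
Qed.

Lemma expectation_intrinsic_ball0 (R : realType) (V : choiceType)
    (E : set {fset V}) (mu : probability (config E) R) (x : V) (n : nat) :
  bounded_degree E -> bernoulli_percolation 0 mu ->
  (\int[mu]_w counting (intrinsic_ball w x n) <= 1)%E.
Proof.
move=> degE muE.
have /finite_fsetP[F FE] := finite_edges_within x n degE.
have [Y xY] := intrinsic_ball_finite_range x n degE.
have xF : edges_within x n `<=` [set` F] by rewrite FE.
have xxY : x \in Y by apply: (xY (fun=> false)); exists [::].
have local y := witnessed_depends_only_on (intrinsic_ball_witnessed (y := y) xF).
rewrite (expectation_intrinsic_ball _ xF xY) (big_fsetD1 x)//= big_seq big1.
  by rewrite adde0; apply: probability_le1; exact: measurable_depends_only_on (local x).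
move=> y; rewrite !inE => /andP[/eqP yx _].
by apply: percolation0_local_event muE (local y) _ => /= /closed_intrinsic_ball.
Qed.

Lemma counting_ge0 (R : realType) (T : choiceType) (B : set T) :
  (0 <= counting B :> \bar R)%E.
Proof. by rewrite /counting; case: ifP => _; rewrite ?leey// lee_fin. Qed.

Lemma counting_intrinsic_ball_le_cluster (R : realType) (V : choiceType)
    (E : set {fset V}) (w : config E) (x : V) (n : nat) :
  (counting (intrinsic_ball w x n) <= counting (open_cluster w x) :> \bar R)%E.
Proof.
have sub : intrinsic_ball w x n `<=` open_cluster w x.
  by move=> y [s [ps _]]; exists s.
rewrite /counting; have [finC|infC] := pselect (finite_set (open_cluster w x)).
  have finB := sub_finite_set sub finC.
  by rewrite !asboolT// lee_fin ler_nat fsubset_leq_card// -fset_set_sub.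
by rewrite (asboolF infC) leey.
Qed.

(** If no parameter percolates, the infimum is that of the empty set, which is 0
    by convention and still lies in the unit interval. *)
Lemma critical_prob_bounds (R : realType) (V : choiceType) (E : set {fset V})
    (P : R -> probability (config E) R) (x : V) :
  0 <= critical_prob P x <= 1.
Proof.
rewrite /critical_prob; set S := [set p | _].
have lbS : lbound S 0 by move=> p [/andP[]].
have [S0|] := pselect (has_inf S); last first.
  by move/inf_out => ->; rewrite lexx ler01.
have [[p Sp] _] := S0.
rewrite lb_le_inf//=; last by exists p.
have [/andP[_ p1] _] := Sp.
by apply: le_trans p1; apply: ge_inf Sp; exists 0.
Qed.

(** * From critical balls to subcritical clusters *)

Lemma bernoulli_inequality (R : realDomainType) (h : R) (n : nat) :
  0 <= h <= 1 -> 1 - n%:R * h <= (1 - h) ^+ n.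
Proof.
move=> /andP[h0 h1]; elim: n => [|n IH]; first by rewrite mul0r subr0 expr0.
rewrite exprS; apply: (@le_trans _ _ ((1 - h) * (1 - n%:R * h))).
  have := mulr_ge0 (ler0n R n) (mulr_ge0 h0 h0).
  by rewrite -natr1; lra.
by rewrite ler_wpM2l// subr_ge0.
Qed.

Theorem theorem1 (R : realType) (V : choiceType) (E : set {fset V})
    (P : R -> probability (config E) R) (x : V) :
  simple_graph E ->
  infinite_set [set: V] ->
  connected_graph E ->
  bounded_degree E ->
  (forall p : R, 0 <= p <= 1 -> bernoulli_percolation p (P p)) ->
  (exists C1 : R, forall p : R, 0 <= p < critical_prob P x ->
    (\int[P p]_w counting (open_cluster w x)
       <= (C1 * (critical_prob P x - p)^-1)%:E)%E) ->
  exists C2 : R, forall n : nat, (1 <= n)%N ->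
    (\int[P (critical_prob P x)]_w counting (intrinsic_ball w x n)
       <= (C2 * n%:R)%:E)%E.
Proof.
move=> _ _ _ degE PE [C1 clusterE].
have pc01 := critical_prob_bounds P x.
move: clusterE pc01; set pc := critical_prob P x => clusterE pc01.
have /andP[pc0 pc1] := pc01.
have [pc_eq0|pc_neq0] := eqVneq pc 0.
  exists 1 => n n1; rewrite mul1r.
  apply: le_trans (expectation_intrinsic_ball0 x n degE _) _.
    by rewrite -{1}pc_eq0; exact: PE.
  by rewrite lee_fin ler1n.
have pc_gt0 : 0 < pc by rewrite lt_neqAle eq_sym pc_neq0.
exists (4 * C1 / pc) => n n1.
have n_gt0 : 0 < n%:R :> R by rewrite ltr0n.
(* The subcritical parameter is [pc * (1 - h)]. Any [h] of order [1 / n] would do,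
   as [(1 - h) ^+ n] has to stay bounded below and [pc * h] of order [1 / n]. *)
pose h : R := (2 * n%:R)^-1.
have h_gt0 : 0 < h by rewrite invr_gt0 mulr_gt0.
have nh : n%:R * h = 2^-1.
  by rewrite /h invfM mulrCA divff ?mulr1// gt_eqF.
have h_le1 : h <= 1.
  have : 1 <= n%:R :> R by rewrite ler1n.
  by move=> n_ge1; rewrite invf_le1 ?mulr_gt0//; lra.
have r01 : 0 <= 1 - h <= 1 by apply/andP; split; lra.
have half_le : 2^-1 <= (1 - h) ^+ n.
  apply: le_trans (bernoulli_inequality n _); first by rewrite nh; lra.
  by rewrite (ltW h_gt0).
have p_lt : 0 <= pc * (1 - h) < pc.
  by rewrite mulr_ge0 ?gtr_pMr//=; lra.
have p01 : 0 <= pc * (1 - h) <= 1.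
  by have /andP[-> /ltW /le_trans ->] := p_lt.
have := expectation_intrinsic_ball_thinning x n degE pc01 r01 (PE _ pc01) (PE _ p01).
set I := (\int[P pc]_w _)%E => thin.
have I0 : (0 <= I)%E by apply: integral_ge0 => w _; exact: counting_ge0.
have : ((2^-1)%:E * I <= (C1 * (pc - pc * (1 - h))^-1)%:E)%E.
  apply: le_trans (clusterE _ p_lt).
  apply: le_trans (ge0_le_integral_nonmeasurable _ _ _); last first.
  - by move=> w; exact: counting_intrinsic_ball_le_cluster n.
  - by move=> w; exact: counting_ge0.
  by apply: le_trans thin; rewrite lee_wpmul2r// lee_fin.
rewrite lee_pdivrMl// -EFinM; congr (_ <= _%:E)%E.
have -> : pc - pc * (1 - h) = pc * h by ring.
rewrite /h; field.
by rewrite pc_neq0 (gt_eqF n_gt0).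
Qed.
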